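(* Let $A$ be a residuated lattice and let $S(A)=\{x\in A : \text{there exists } e\in \mathcal{B}(A) \text{ with } e\leftrightarrow x\in [x\vee \neg x)\}$. The following statements are equivalent: (1) $A$ has the Boolean Lifting Property (BLP); (2) for all $x\in A$, there exists $e\in \mathcal{B}(A)$ such that $e\leftrightarrow x\in [x\vee \neg x)$; (3) for all $x\in A$, there exists $e\in \mathcal{B}(A)$ such that $e\in [x)$ and $\neg e\in [\neg x)$; (4) $S(A)=A$.
   Context: A residuated lattice is a commutative integral bounded one: a structure $(A,\vee ,\wedge ,\odot ,\rightarrow ,0,1)$ such that $(A,\vee ,\wedge ,0,1)$ is a bounded lattice, $(A,\odot ,1)$ is a commutative monoid, and $a\leq b\rightarrow c$ iff $a\odot b\leq c$ for all $a,b,c$. Write $\neg a=a\rightarrow 0$, $a\leftrightarrow b=(a\rightarrow b)\wedge (b\rightarrow a)$, and $a^n$ for the $n$-fold $\odot$-power. $\mathcal{B}(A)$ is the set of complemented elements of the bounded lattice reduct of $A$. A filter of $A$ is a nonempty subset closed under $\odot$ and upward closed; $[x)=\{y\in A : x^n\leq y \text{ for some } n\geq 1\}$ is the filter generated by $x$. For a filter $F$, $A/F$ is the quotient residuated lattice by the congruence $a\equiv b$ iff $a\leftrightarrow b\in F$, with classes $a/F$. $F$ has BLP iff for every $f\in \mathcal{B}(A/F)$ there is $e\in \mathcal{B}(A)$ with $e/F=f$. $A$ has BLP iff all its filters have BLP. *)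

(* Defs.v *)
From HB Require Import structures.
From mathcomp Require Import all_boot all_order.
From mathcomp Require Import boolp classical_sets.

Set Implicit Arguments.
Unset Strict Implicit.
Unset Printing Implicit Defensive.

Import Order.TTheory.

Local Open Scope quotient_scope.
Local Open Scope classical_set_scope.
Local Open Scope order_scope.

(* The carrier is a choiceType with a boolean order because the order library
   requires it; with the axioms of boolp this is no restriction. The trivial
   algebra \bot = \top is allowed (it occurs as the quotient by setT). *)
HB.mixin Record TBLattice_isResiduated d T of Order.TBLattice d T := {
  rmul : T -> T -> T;
  rimp : T -> T -> T;
  rmulA : associative rmul;
  rmulC : commutative rmul;
  rmul1x : left_id \top rmul;
  rimpP : forall a b c, (a <= rimp b c) = (rmul a b <= c)
}.

#[short(type="residuatedLatticeType")]
HB.structure Definition ResiduatedLattice d :=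
  { T of TBLattice_isResiduated d T & Order.TBLattice d T }.

Declare Scope rl_scope.
Delimit Scope rl_scope with RL.
Local Open Scope rl_scope.

Notation "x \odot y" := (rmul x y) (at level 40, left associativity) : rl_scope.
Notation "x \imp y" := (rimp x y) (at level 55, right associativity) : rl_scope.
Notation "\neg x" := (rimp x \bot) (at level 35, right associativity) : rl_scope.
Notation "x \eqv y" := (Order.meet (rimp x y) (rimp y x))
  (at level 56, no associativity) : rl_scope.

Definition rpow d (A : residuatedLatticeType d) (x : A) (n : nat) : A :=
  iterop n rmul x \top.

Definition boolean_elems d (L : tbLatticeType d) : set L :=
  [set e : L | exists f : L, e `&` f = \bot /\ e `|` f = \top].

Arguments boolean_elems {d} L.

Definition principal_filter d (A : residuatedLatticeType d) (x : A) : set A :=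
  [set y : A | exists2 n, (1 <= n)%N & rpow x n <= y].

Record rl_filter d (A : residuatedLatticeType d) := RLFilter {
  rl_filter_set :> A -> Prop;
  rl_filter_nonempty : exists x, rl_filter_set x;
  rl_filterM : forall x y,
    rl_filter_set x -> rl_filter_set y -> rl_filter_set (x \odot y);
  rl_filterS : forall x y, x <= y -> rl_filter_set x -> rl_filter_set y
}.

Section BasicTheory.
Context d (A : residuatedLatticeType d).
Implicit Types a b c f g : A.

Lemma rmulx1 : right_id (\top : A) rmul.
Proof. by move=> a; rewrite rmulC rmul1x. Qed.

Lemma rmulS a b a' b' : a <= a' -> b <= b' -> a \odot b <= a' \odot b'.
Proof.
move=> aa' bb'; apply: (@le_trans _ _ (a' \odot b)).
  by rewrite -rimpP (le_trans aa') // rimpP.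
by rewrite !(rmulC a') -rimpP (le_trans bb') // rimpP.
Qed.

Lemma rmul_lel a b : a \odot b <= a.
Proof. by rewrite -[leRHS]rmulx1 rmulS ?lex1. Qed.

Lemma rmul_ler a b : a \odot b <= b.
Proof. by rewrite rmulC rmul_lel. Qed.

End BasicTheory.

Section Quotient.
Context d (A : residuatedLatticeType d) (F : rl_filter A).
Implicit Types a b c : A.

Definition rl_congr a b : bool := `[< F (a \eqv b) >].

Definition rl_leF a b : Prop := F (a \imp b).

Lemma rl_leFP a b : rl_leF a b <-> exists2 f, F f & f \odot a <= b.
Proof.
split=> [Fab | [f Ff fab]]; first by exists (a \imp b); rewrite // -rimpP.
by apply: rl_filterS Ff; rewrite rimpP.
Qed.

Lemma rl_leF_le a b : a <= b -> rl_leF a b.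
Proof.
move=> ab; have [f Ff] := rl_filter_nonempty F.
by apply/rl_leFP; exists f; rewrite // (le_trans (rmul_ler _ _)).
Qed.

Lemma rl_leF_trans b a c : rl_leF a b -> rl_leF b c -> rl_leF a c.
Proof.
move=> /rl_leFP[f Ff fab] /rl_leFP[g Fg gbc]; apply/rl_leFP.
exists (g \odot f); first exact: rl_filterM.
by rewrite -rmulA (le_trans _ gbc) // rmulS.
Qed.

Lemma rl_leFI a b c : rl_leF a (b `&` c) <-> rl_leF a b /\ rl_leF a c.
Proof.
split=> [h | [/rl_leFP[f Ff fab] /rl_leFP[g Fg gac]]].
  by split; apply: rl_leF_trans h (rl_leF_le _); rewrite ?leIl ?leIr.
apply/rl_leFP; exists (f \odot g); first exact: rl_filterM.
rewrite lexI (le_trans _ fab) ?(le_trans _ gac) ?rmulS ?rmul_ler //.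
exact: rmul_lel.
Qed.

Lemma rl_leFU a b c : rl_leF (a `|` b) c <-> rl_leF a c /\ rl_leF b c.
Proof.
split=> [h | [/rl_leFP[f Ff fab] /rl_leFP[g Fg gac]]].
  by split; apply: rl_leF_trans (rl_leF_le _) h; rewrite ?leUl ?leUr.
apply/rl_leFP; exists (f \odot g); first exact: rl_filterM.
rewrite rmulC -rimpP leUx !rimpP !(rmulC _ (f \odot g)).
rewrite (le_trans _ fab) ?(le_trans _ gac) ?rmulS ?rmul_ler //.
exact: rmul_lel.
Qed.

Lemma rl_leFM a b a' b' :
  rl_leF a a' -> rl_leF b b' -> rl_leF (a \odot b) (a' \odot b').
Proof.
move=> /rl_leFP[f Ff fab] /rl_leFP[g Fg gac]; apply/rl_leFP.
exists (f \odot g); first exact: rl_filterM.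
by rewrite rmulA -(rmulA f) (rmulC g) rmulA -rmulA rmulS.
Qed.

Lemma rl_leF_imp a b c : rl_leF a (b \imp c) <-> rl_leF (a \odot b) c.
Proof.
by split=> /rl_leFP[f Ff h]; apply/rl_leFP; exists f => //; move: h;
  rewrite rimpP rmulA.
Qed.

Lemma rl_leFR a b a' b' :
  rl_leF a' a -> rl_leF b b' -> rl_leF (a \imp b) (a' \imp b').
Proof.
move=> aa bb; apply/rl_leF_imp.
apply: rl_leF_trans (rl_leFM (rl_leF_le (lexx _)) aa) _.
by apply: rl_leF_trans bb; apply/rl_leF_imp/rl_leF_le.
Qed.

Lemma rl_congrP a b : reflect (rl_leF a b /\ rl_leF b a) (rl_congr a b).
Proof.
rewrite /rl_congr; apply: (iffP (asboolP _)) => [h | [ab ba]].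
  by split; apply: rl_filterS h; rewrite ?leIl ?leIr.
by apply: rl_filterS (rl_filterM ab ba); rewrite lexI rmul_lel rmul_ler.
Qed.

Lemma rl_congr_equiv : equiv_class_of rl_congr.
Proof.
split=> [a | a b | b a c].
- by apply/rl_congrP; split; apply: rl_leF_le.
- by apply/rl_congrP/rl_congrP => -[].
- move=> /rl_congrP[ab ba] /rl_congrP[bc cb].
  by apply/rl_congrP; split; apply: (@rl_leF_trans b).
Qed.

Canonical rl_congr_equivRel := EquivRelPack rl_congr_equiv.

Definition rl_quot := {eq_quot rl_congr}.
HB.instance Definition _ := Choice.on rl_quot.
HB.instance Definition _ := EqQuotient.on rl_quot.

Lemma rl_quotP a b : \pi_rl_quot a = \pi_rl_quot b <-> rl_leF a b /\ rl_leF b a.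
Proof.
by split=> [/eqmodP/rl_congrP | h]; last exact/eqmodP/rl_congrP.
Qed.

Lemma rl_reprF a : rl_leF (repr (\pi_rl_quot a)) a /\
                   rl_leF a (repr (\pi_rl_quot a)).
Proof. by apply/rl_quotP; rewrite reprK. Qed.

Implicit Types x y z : rl_quot.

Definition rl_qmeet x y := \pi_rl_quot (repr x `&` repr y).
Definition rl_qjoin x y := \pi_rl_quot (repr x `|` repr y).
Definition rl_qmul x y := \pi_rl_quot (repr x \odot repr y).
Definition rl_qimp x y := \pi_rl_quot (repr x \imp repr y).
Definition rl_qle x y := rl_qmeet x y == x.

Lemma rl_qmeet_pi a b :
  rl_qmeet (\pi_rl_quot a) (\pi_rl_quot b) = \pi_rl_quot (a `&` b).
Proof.
have [a1 a2] := rl_reprF a; have [b1 b2] := rl_reprF b.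
apply/rl_quotP; split; apply/rl_leFI; split.
- by apply: rl_leF_trans a1; apply: rl_leF_le; rewrite leIl.
- by apply: rl_leF_trans b1; apply: rl_leF_le; rewrite leIr.
- by apply: rl_leF_trans a2; apply: rl_leF_le; rewrite leIl.
- by apply: rl_leF_trans b2; apply: rl_leF_le; rewrite leIr.
Qed.

Lemma rl_qjoin_pi a b :
  rl_qjoin (\pi_rl_quot a) (\pi_rl_quot b) = \pi_rl_quot (a `|` b).
Proof.
have [a1 a2] := rl_reprF a; have [b1 b2] := rl_reprF b.
apply/rl_quotP; split; apply/rl_leFU; split.
- by apply: rl_leF_trans a1 _; apply: rl_leF_le; rewrite leUl.
- by apply: rl_leF_trans b1 _; apply: rl_leF_le; rewrite leUr.
- by apply: rl_leF_trans a2 _; apply: rl_leF_le; rewrite leUl.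
- by apply: rl_leF_trans b2 _; apply: rl_leF_le; rewrite leUr.
Qed.

Lemma rl_qmul_pi a b :
  rl_qmul (\pi_rl_quot a) (\pi_rl_quot b) = \pi_rl_quot (a \odot b).
Proof.
have [a1 a2] := rl_reprF a; have [b1 b2] := rl_reprF b.
by apply/rl_quotP; split; apply: rl_leFM.
Qed.

Lemma rl_qimp_pi a b :
  rl_qimp (\pi_rl_quot a) (\pi_rl_quot b) = \pi_rl_quot (a \imp b).
Proof.
have [a1 a2] := rl_reprF a; have [b1 b2] := rl_reprF b.
by apply/rl_quotP; split; apply: rl_leFR.
Qed.

Lemma rl_qle_pi a b :
  reflect (rl_leF a b) (rl_qle (\pi_rl_quot a) (\pi_rl_quot b)).
Proof.
rewrite /rl_qle rl_qmeet_pi; apply: (iffP eqP) => [/rl_quotP[_ /rl_leFI[]]// |].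
move=> ab; apply/rl_quotP; split; first by apply: rl_leF_le; rewrite leIl.
by apply/rl_leFI; split=> //; apply: rl_leF_le.
Qed.

Lemma rl_qle_refl : reflexive rl_qle.
Proof. by elim/quotW=> a; apply/rl_qle_pi/rl_leF_le. Qed.

Lemma rl_qle_anti : antisymmetric rl_qle.
Proof.
elim/quotW=> a; elim/quotW=> b /andP[/rl_qle_pi ab /rl_qle_pi ba].
exact/rl_quotP.
Qed.

Lemma rl_qle_trans : transitive rl_qle.
Proof.
elim/quotW=> b; elim/quotW=> a; elim/quotW=> c /rl_qle_pi ab /rl_qle_pi bc.
by apply/rl_qle_pi; apply: rl_leF_trans bc.
Qed.

HB.instance Definition _ := Order.Le_isPOrder.Build d rl_quot
  rl_qle_refl rl_qle_anti rl_qle_trans.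

Lemma rl_qmeetP x y z : (x <= rl_qmeet y z) = (x <= y) && (x <= z).
Proof.
elim/quotW: x => a; elim/quotW: y => b; elim/quotW: z => c.
rewrite rl_qmeet_pi; apply/rl_qle_pi/andP => [/rl_leFI[ab ac] | ].
  by split; apply/rl_qle_pi.
by move=> -[/rl_qle_pi ab /rl_qle_pi ac]; apply/rl_leFI.
Qed.

Lemma rl_qjoinP x y z : (rl_qjoin x y <= z) = (x <= z) && (y <= z).
Proof.
elim/quotW: x => a; elim/quotW: y => b; elim/quotW: z => c.
rewrite rl_qjoin_pi; apply/rl_qle_pi/andP => [/rl_leFU[ab ac] | ].
  by split; apply/rl_qle_pi.
by move=> -[/rl_qle_pi ab /rl_qle_pi ac]; apply/rl_leFU.
Qed.

HB.instance Definition _ := Order.POrder_MeetJoin_isLattice.Build d rl_quot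
  rl_qmeetP rl_qjoinP.

Lemma rl_qle0x x : \pi_rl_quot \bot <= x.
Proof. by elim/quotW: x => a; apply/rl_qle_pi/rl_leF_le/le0x. Qed.

Lemma rl_qlex1 x : x <= \pi_rl_quot \top.
Proof. by elim/quotW: x => a; apply/rl_qle_pi/rl_leF_le/lex1. Qed.

HB.instance Definition _ := Order.hasBottom.Build d rl_quot rl_qle0x.
HB.instance Definition _ := Order.hasTop.Build d rl_quot rl_qlex1.

Lemma rl_qmulA : associative rl_qmul.
Proof.
move=> x y z; elim/quotW: x => a; elim/quotW: y => b; elim/quotW: z => c.
by rewrite (rl_qmul_pi b c) (rl_qmul_pi a b) (rl_qmul_pi a) (rl_qmul_pi _ c) rmulA.
Qed.

Lemma rl_qmulC : commutative rl_qmul.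
Proof.
by move=> x y; elim/quotW: x => a; elim/quotW: y => b; rewrite (rl_qmul_pi a) (rl_qmul_pi b) rmulC.
Qed.

Lemma rl_qmul1x : left_id (\top : rl_quot) rl_qmul.
Proof. by move=> x; elim/quotW: x => a; rewrite rl_qmul_pi rmul1x. Qed.

Lemma rl_qimpP x y z : (x <= rl_qimp y z) = (rl_qmul x y <= z).
Proof.
elim/quotW: x => a; elim/quotW: y => b; elim/quotW: z => c.
rewrite rl_qimp_pi rl_qmul_pi.
by apply/rl_qle_pi/rl_qle_pi => /rl_leF_imp.
Qed.

HB.instance Definition _ := TBLattice_isResiduated.Build d rl_quot
  rl_qmulA rl_qmulC rl_qmul1x rl_qimpP.

End Quotient.

Definition filter_BLP d (A : residuatedLatticeType d) (F : rl_filter A) : Prop :=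
  forall f : rl_quot F, boolean_elems (rl_quot F) f ->
    exists2 e : A, boolean_elems A e & \pi_(rl_quot F) e = f.

Definition BLP d (A : residuatedLatticeType d) : Prop :=
  forall F : rl_filter A, filter_BLP F.

Arguments BLP {d} A.

Definition S_set d (A : residuatedLatticeType d) : set A :=
  [set x : A | exists2 e : A, boolean_elems A e &
             principal_filter (x `|` \neg x) (e \eqv x)].

Arguments S_set {d} A.

(* Main.v *)
Require Import Defs.
From HB Require Import structures.
From mathcomp Require Import all_boot all_order.
From mathcomp Require Import boolp classical_sets.

(** Write Fil(x) for the filter generated by x. Two facts about the elements
    x \/ ~x carry the proof.
    - The class of x in A/F is complemented iff x \/ ~x belongs to F
      ([boolean_quotP]): if y/F is a complement of x/F then x (.) y lies below
      x /\ y, hence y is below ~x modulo F, so that x \/ ~x is the top modulo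
      F; conversely x \/ ~x in F annihilates x /\ ~x. Thus Fil(x \/ ~x) is the
      least filter modulo which x becomes Boolean, and an e lifting x modulo
      it lifts x modulo every filter that makes x Boolean. Hence lifting for
      all filters amounts to e <-> x in Fil(x \/ ~x).
    - Fil(x \/ ~x) is the intersection of Fil(x) and Fil(~x), because
      (a \/ b)^(m + n) lies below a^m \/ b^n ([rpow_joinD_le]). Modulo Fil(x)
      the element x is the top, so that e <-> x amounts to e there; modulo
      Fil(~x) it is the bottom, and e <-> x amounts to ~e. Hence e <-> x is in
      Fil(x \/ ~x) iff e is in Fil(x) and ~e is in Fil(~x)
      ([principal_eqv_split], [principal_eqv_join]).
    That e is Boolean in A plays no role in these transfers: the same e serves
    in every condition. *)

Import Order.TTheory.

Local Open Scope quotient_scope.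
Local Open Scope order_scope.
Local Open Scope rl_scope.

Section BooleanLifting.
Context (d : Order.disp_t) (A : residuatedLatticeType d).
Implicit Types a b c e x y : A.

Lemma rmulUl a b c : (a `|` b) \odot c = (a \odot c) `|` (b \odot c).
Proof.
apply/le_anti/andP; split.
  by rewrite -rimpP leUx !rimpP leUl leUr.
by rewrite leUx !rmulS ?leUl ?leUr.
Qed.

Lemma rmul_neg x : x \odot \neg x = \bot.
Proof. by apply/eqP; rewrite -lex0 rmulC -rimpP. Qed.

Lemma rpowS x n : rpow x n.+1 = x \odot rpow x n.
Proof. by case: n => [|n] //=; rewrite /rpow /= rmulx1. Qed.

Lemma rpow_lex x n : (1 <= n)%N -> rpow x n <= x.
Proof. by case: n => // n _; rewrite rpowS rmul_lel. Qed.

Lemma rpowD x m n : rpow x (m + n) = rpow x m \odot rpow x n.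
Proof.
elim: m => [|m IH]; first by rewrite add0n rmul1x.
by rewrite addSn !rpowS IH rmulA.
Qed.

Lemma rpow_le x y n : x <= y -> rpow x n <= rpow y n.
Proof. by move=> xy; elim: n => [|n IH] //; rewrite !rpowS rmulS. Qed.

Lemma rpow_joinD_le a b m n :
  rpow (a `|` b) (m + n) <= rpow a m `|` rpow b n.
Proof.
elim: m n => [|m IHm] n; first by rewrite (le_trans (lex1 _)) ?leUl.
elim: n => [|n IHn]; first by rewrite (le_trans (lex1 _)) ?leUr.
rewrite addnS [leLHS]rpowS rmulUl leUx; apply/andP; split.
  rewrite addSnnS (le_trans (rmulS (lexx a) (IHm n.+1))) // rmulC rmulUl.
  by rewrite !(rmulC _ a) -rpowS leU2 ?rmul_ler.
rewrite (le_trans (rmulS (lexx b) IHn)) // rmulC rmulUl.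
by rewrite !(rmulC _ b) -rpowS leU2 ?rmul_ler.
Qed.

Lemma meet_le_eqv a b : a `&` b <= (a \eqv b).
Proof.
rewrite lexI !rimpP (le_trans (rmul_lel _ _)) ?leIr //.
by rewrite (le_trans (rmul_lel _ _)) ?leIl.
Qed.

Lemma meet_neg_le_eqv a b : \neg a `&` \neg b <= (a \eqv b).
Proof.
have neg_imp c c' : \neg c <= c \imp c'.
  by rewrite rimpP rmulC rmul_neg le0x.
by rewrite lexI; apply/andP; split; apply: le_trans (neg_imp _ _);
  rewrite ?leIl ?leIr.
Qed.

Lemma principal_filter_id x : principal_filter x x.
Proof. by exists 1%N. Qed.

(** The filter generated by x, as a bundled filter. *)
Definition rl_principal x : rl_filter A.
Proof.
refine (@RLFilter d A (principal_filter x) _ _ _).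
- by exists x; apply: principal_filter_id.
- move=> y z [m m1 my] [n n1 nz]; exists (m + n)%N; first by rewrite addn_gt0 m1.
  by rewrite rpowD rmulS.
- by move=> y z yz [n n1 ny]; exists n; rewrite ?(le_trans ny).
Defined.

(** The principal filter is the least filter containing its generator. *)
Lemma principal_filter_sub (F : rl_filter A) x y :
  F x -> principal_filter x y -> F y.
Proof.
move=> Fx [n n1 ny]; apply: rl_filterS ny _.
case: n n1 => // n _; elim: n => // n IH.
by rewrite rpowS; apply: rl_filterM.
Qed.

Lemma quot_eqvP (F : rl_filter A) a b :
  \pi_(rl_quot F) a = \pi_(rl_quot F) b <-> F (a \eqv b).
Proof. by split=> [/eqmodP/asboolP | ?]; last exact/eqmodP/asboolP. Qed.

Lemma rl_leF_top (F : rl_filter A) a : rl_leF F \top a <-> F a.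
Proof.
split=> [/rl_leFP[f Ff] | Fa]; first by rewrite rmulx1 => /rl_filterS; apply.
by apply/rl_leFP; exists a; rewrite ?rmulx1.
Qed.

(** An element becomes complemented in the quotient by F exactly when F
    contains the join of the element and its negation. *)
Lemma boolean_quotP (F : rl_filter A) x :
  boolean_elems (rl_quot F) (\pi_(rl_quot F) x) <-> F (x `|` \neg x).
Proof.
split=> [[q] | Fx].
  elim/quotW: q => y [xy_bot xy_top].
  have /rl_quotP[xy0 _] : \pi_(rl_quot F) (x `&` y) = \pi_(rl_quot F) \bot.
    by rewrite -rl_qmeet_pi; apply: xy_bot.
  have /rl_quotP[_ xy1] : \pi_(rl_quot F) (x `|` y) = \pi_(rl_quot F) \top.
    by rewrite -rl_qjoin_pi; apply: xy_top.
  have yNx : rl_leF F y (\neg x).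
    apply/rl_leF_imp; apply: rl_leF_trans xy0; apply: rl_leF_le.
    by rewrite lexI rmul_ler rmul_lel.
  apply/rl_leF_top; apply: rl_leF_trans xy1 _; apply/rl_leFU; split.
    by apply: rl_leF_le; rewrite leUl.
  by apply: rl_leF_trans yNx _; apply: rl_leF_le; rewrite leUr.
exists (\pi_(rl_quot F) (\neg x)); split.
  rewrite [LHS]rl_qmeet_pi; apply/rl_quotP; split; last exact/rl_leF_le/le0x.
  apply/rl_leFP; exists (x `|` \neg x) => //.
  have xNx0 := rmul_neg x; rewrite rmulUl leUx; apply/andP; split.
    by rewrite -[leRHS]xNx0 rmulS ?leIr.
  by rewrite -[leRHS]xNx0 rmulC rmulS ?leIl.
rewrite [LHS]rl_qjoin_pi; apply/rl_quotP; split; first exact/rl_leF_le/lex1.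
exact/rl_leF_top.
Qed.

Lemma BLP_principal x : BLP A ->
  exists2 e : A, boolean_elems A e &
    principal_filter (x `|` \neg x) (e \eqv x).
Proof.
move=> blp; pose F := rl_principal (x `|` \neg x).
have /blp[e Be /quot_eqvP ex] : boolean_elems (rl_quot F) (\pi_(rl_quot F) x).
  by apply/boolean_quotP; apply: principal_filter_id.
by exists e.
Qed.

Lemma principal_eqv_split e x :
  principal_filter (x `|` \neg x) (e \eqv x) ->
  principal_filter x e /\ principal_filter (\neg x) (\neg e).
Proof.
move=> [n n1 nex].
have xn : rpow x n <= x \imp e.
  by rewrite (le_trans (rpow_le _ _ n (leUl x (\neg x)))) ?(le_trans nex) ?leIr.
have Nxn : rpow (\neg x) n <= e \imp x.
  by rewrite (le_trans (rpow_le _ _ n (leUr (\neg x) x))) ?(le_trans nex) ?leIl.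
split; exists n.+1 => //; first by rewrite rpowS rmulC -rimpP.
by rewrite rpowS rimpP -rmulA -[leRHS](rmul_neg x) (rmulC x) rmulS // -rimpP.
Qed.

Lemma principal_eqv_join e x :
  principal_filter x e -> principal_filter (\neg x) (\neg e) ->
  principal_filter (x `|` \neg x) (e \eqv x).
Proof.
move=> [m m1 me] [n n1 ne]; exists (m + n)%N; first by rewrite addn_gt0 m1.
rewrite (le_trans (rpow_joinD_le _ _ _ _)) // leUx; apply/andP; split.
  by rewrite (le_trans _ (meet_le_eqv _ _)) // lexI me rpow_lex.
by rewrite (le_trans _ (meet_neg_le_eqv _ _)) // lexI ne rpow_lex.
Qed.

Lemma principal_BLP :
  (forall x, exists2 e : A, boolean_elems A e &
     principal_filter (x `|` \neg x) (e \eqv x)) -> BLP A.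
Proof.
move=> lift F; elim/quotW=> x /boolean_quotP Fx.
have [e Be ex] := lift x; exists e => //.
exact/quot_eqvP/(principal_filter_sub _ _ _ Fx).
Qed.

End BooleanLifting.

Theorem proposition4p6 (d : Order.disp_t) (A : residuatedLatticeType d) :
  [<-> (* 1 *) BLP A;
       (* 2 *) forall x : A, exists2 e : A, boolean_elems A e &
                 principal_filter (x `|` \neg x) (e \eqv x);
       (* 3 *) forall x : A, exists2 e : A, boolean_elems A e &
                 principal_filter x e /\ principal_filter (\neg x) (\neg e);
       (* 4 *) S_set A = [set: A]%classic ].
Proof.
tfae=> [blp x | lift x | lift | SA].
- exact: BLP_principal.
- have [e Be ex] := lift x; exists e => //; exact: principal_eqv_split.
- apply/seteqP; split=> // x _; have [e Be [xe Nxe]] := lift x.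
  by exists e => //; apply: principal_eqv_join.
- by apply: principal_BLP => x; have : S_set A x by rewrite SA.
Qed.
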